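(* Let $(\mathcal P_n)_{n\ge 1}$ be a sequence of point sets $\mathcal P_n\subset\mathbb R^2$ with $|\mathcal P_n|=n$ and $D(\mathcal P_n)=o(n)$ as $n\to\infty$. Then no line contains $\Omega(n^{7/8})$ points of $\mathcal P_n$; that is, for every constant $c>0$ there exists $n_0$ such that for all $n\ge n_0$ there is no line $\ell\subset\mathbb R^2$ with $|\mathcal P_n\cap \ell|\ge c\,n^{7/8}$.
   Context: For a finite set $\mathcal P\subset\mathbb R^2$, $D(\mathcal P)$ denotes the number of distinct Euclidean distances determined by pairs of points of $\mathcal P$. *)

(* Defs.v *)
From mathcomp Require Import all_boot all_order all_algebra finmap.
From mathcomp Require Import all_classical all_reals all_analysis.

Set Implicit Arguments.
Unset Strict Implicit.
Unset Printing Implicit Defensive.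

Import Order.TTheory GRing.Theory Num.Theory.

Local Open Scope classical_set_scope.
Local Open Scope fset_scope.
Local Open Scope ring_scope.

(* The canonical norm on [R * R] is the sup norm, hence an explicit Euclidean
   distance. *)
Definition euclidean_dist (R : realType) (p q : R * R) : R :=
  Num.sqrt ((p.1 - q.1) ^+ 2 + (p.2 - q.2) ^+ 2).

(* Pairs of points are pairs of distinct points: the distance 0 is not
   counted. *)
Definition distances (R : realType) (P : {fset R * R}) : {fset R} :=
  [fset euclidean_dist p q | p in P, q in P & p != q].

Definition num_distances (R : realType) (P : {fset R * R}) : nat :=
  #|` distances P|.

Definition is_line (R : realType) (l : set (R * R)) : Prop :=
  exists a b c : R,
    (a, b) <> (0, 0) /\ l = [set p : R * R | a * p.1 + b * p.2 = c].

Definition num_points_on (R : realType) (P : {fset R * R})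
    (l : set (R * R)) : nat :=
  #|` [fset p in P | p \in l]|.

(* Main.v *)
(* Put the heavy line on the horizontal axis, let A be the set of abscissas of
   its m points and Q the set of points of P strictly on one side, and write
   d = 2 D + 1.  Then A - A has at most d elements, and so has the set V of
   squared distances (a - x)^2 + y^2 with a in A and (x, y) in Q.

   First, a column {x} x Y of Q has at most O(d^4 / m^4) points: for b in A and
   y in Y the parabola s -> (s + b - x)^2 + y^2 contains m points of the grid
   (A - A) x V, and two points determine the parabola (Elekes, Nathanson, Ruzsa).

   Second, by Cauchy-Schwarz there are at least m^2 |Q|^2 / d solutions of
   dist(a, q) = dist(b, q').  A pair (q, q') with y <> y' defines a hyperbola
   (a - x)^2 - (b - x')^2 = y'^2 - y^2 in the (a, b)-plane; three points of A x A
   determine x, x' and y'^2 - y^2, so they lie on at most as many of these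
   hyperbolas as there are points in a column.  The pairs with y = y' account for
   at most 2 m^2 |Q| solutions.

   In both cases the curves split into four monotone pieces and the points
   form a Cartesian product, so no crossing or partitioning theorem is needed:
   cut the product into blocks of w x w points, consecutive in each
   coordinate; if there are t blocks in each direction, a curve meets O(t) of
   them, and within blocks one counts pairs, resp. triples, of points on a
   curve. The outcome is |Q|^2 m^8 = O(d^9), which rules out m >= c n^(7/8)
   when d = o(n) and |Q| >= n / 4. *)
Require Import Defs.
From mathcomp Require Import all_boot all_order all_algebra finmap.
From mathcomp Require Import zify ring lra.

Set Implicit Arguments.
Unset Strict Implicit.
Unset Printing Implicit Defensive.

Import Order.TTheory GRing.Theory Num.Theory.

(** * Counting pairs and triples in blocks *)

Lemma leq_card_offdiag (I : finType) (F : {set I}) :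
  #|F| <= 1 + #|[set p : I * I | [&& p.1 \in F, p.2 \in F & p.1 != p.2]]|.
Proof.
have [|/card_gt1P [r [r' [rF r'F _]]]] := leqP #|F| 1; first by lia.
rewrite (cardsD1 r) rF leq_add2l.
have inj : injective (fun i : I => (i, r)) by move=> i j [].
rewrite -(card_imset _ inj); apply/subset_leq_card/fintype.subsetP => _ /imsetP[i + ->].
by rewrite !inE /= rF => /andP[-> ->].
Qed.

Lemma leq_card_distinct3 (I : finType) (F : {set I}) :
  #|F| <= 2 + #|[set p : I * I * I |
    [&& p.1.1 \in F, p.1.2 \in F, p.2 \in F,
        p.1.1 != p.1.2, p.1.1 != p.2 & p.1.2 != p.2]]|.
Proof.
have [|/card_gt2P [r [r' [_ [[rF r'F _] [rr' _ _]]]]]] := leqP #|F| 2; first by lia.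
rewrite (cardsD1 r) rF (cardsD1 r' (F :\ r)) !inE r'F eq_sym rr' addnA leq_add2l.
have inj : injective (fun i : I => (i, r, r')) by move=> i j [].
rewrite -(card_imset _ inj); apply/subset_leq_card/fintype.subsetP => _ /imsetP[i + ->].
by rewrite !inE /= rF r'F rr' !andbT => /and3P[-> -> ->].
Qed.

Lemma sum_card_fibers (I H : finType) (h : I -> H) (S : {set I}) :
  #|S| = \sum_c #|[set i in S | h i == c]|.
Proof.
rewrite -sum1_card (partition_big h predT) //=; apply: eq_bigr => c _.
by rewrite -sum1_card; apply: eq_bigl => i; rewrite inE.
Qed.

(** Fix [r] in a nonempty fibre of [h] on [S]: the pairs [(i, r)] pay for every other [i], so each
    fibre leaves at most one element unpaid. *)
Lemma leq_card_pairs (I H : finType) (h : I -> H) (S : {set I}) :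
  #|S| <= #|H| + #|[set p : I * I |
    [&& p.1 \in S, p.2 \in S, p.1 != p.2 & h p.1 == h p.2]]|.
Proof.
rewrite (sum_card_fibers h) (sum_card_fibers (fun p => h p.1) [set p : I * I | _]).
rewrite -[X in X + _]sum1_card -big_split /=; apply: leq_sum => c _.
apply: leq_trans (leq_card_offdiag _) _; rewrite leq_add2l.
apply/subset_leq_card/fintype.subsetP => -[i j]; rewrite !inE /=.
by move=> /and3P[/andP[-> /eqP->] /andP[-> /eqP->] ->]; rewrite !eqxx.
Qed.

Lemma leq_card_triples (I H : finType) (h : I -> H) (S : {set I}) :
  #|S| <= 2 * #|H| + #|[set p : I * I * I |
    [&& [&& p.1.1 \in S, p.1.2 \in S & p.2 \in S],
        [&& p.1.1 != p.1.2, p.1.1 != p.2 & p.1.2 != p.2],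
        h p.1.1 == h p.1.2 & h p.1.1 == h p.2]]|.
Proof.
rewrite (sum_card_fibers h) (sum_card_fibers (fun p => h p.1.1) [set p : I * I * I | _]).
rewrite -sum1_card big_distrr -big_split /=; apply: leq_sum => c _.
apply: leq_trans (leq_card_distinct3 _) _; rewrite leq_add2l.
apply/subset_leq_card/fintype.subsetP => -[[i j] l]; rewrite !inE /=.
move=> /andP[/andP[-> /eqP->]] /andP[/andP[-> /eqP->]].
by move=> /andP[/andP[-> /eqP->]] /and3P[-> -> ->]; rewrite !eqxx.
Qed.

(** The squares of the fibre sizes [n v] count the collisions; sum
    [2 * (n v * n v') <= n v ^ 2 + n v' ^ 2] over all [v] and [v']. *)
Lemma collision_Cauchy_Schwarz (X V : finType) (f : X -> V) :
  #|X| ^ 2 <= #|V| * #|[set p : X * X | f p.1 == f p.2]|.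
Proof.
pose n v := #|[set x | f x == v]|.
have cardX : #|X| = \sum_v n v.
  rewrite -cardsT (sum_card_fibers f); apply: eq_bigr => v _.
  by apply: eq_card => x; rewrite !inE.
have -> : #|[set p : X * X | f p.1 == f p.2]| = \sum_v n v ^ 2.
  rewrite (sum_card_fibers (fun p => f p.1)); apply: eq_bigr => v _.
  rewrite -mulnn /n -cardsX; apply: eq_card => -[x y]; rewrite !inE /=.
  by apply/andP/andP => -[/eqP e /eqP e']; split; apply/eqP; congruence.
rewrite -(leq_pmul2l (isT : 0 < 2)) cardX -mulnn big_distrlr /=.
have -> : 2 * (#|V| * \sum_v n v ^ 2) = \sum_v \sum_v' (n v ^ 2 + n v' ^ 2).
  apply/esym; under eq_bigr => v _ do rewrite big_split /= sum_nat_const.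
  by rewrite big_split /= sum_nat_const -big_distrr /= addnn mul2n.
rewrite big_distrr /=; apply: leq_sum => v _; rewrite big_distrr /=.
by apply: leq_sum => v' _; exact: nat_Cauchy.
Qed.

(** * Ranks and blocks in one coordinate *)

Section Blocks.
Variables (R : realDomainType) (T : finType) (val : T -> R) (w : nat).
Hypothesis val_inj : injective val.

Definition rank (s : T) : nat := #|[set r | (val r < val s)%R]|.

Definition block (s : T) : nat := rank s %/ w.

Lemma leq_rank s s' : (val s <= val s')%R -> rank s <= rank s'.
Proof.
move=> le; apply/subset_leq_card/fintype.subsetP => r; rewrite !inE => lt.
exact: lt_le_trans le.
Qed.

Lemma ltn_rank s s' : (val s < val s')%R -> rank s < rank s'.
Proof.
move=> lt; apply/proper_card/properP; split; last first.
  by exists s; rewrite !inE ?lt ?ltxx.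
by apply/fintype.subsetP => r; rewrite !inE => lt'; exact: lt_trans lt.
Qed.

Lemma rank_inj : injective rank.
Proof.
move=> s s' e; apply: val_inj; apply/eqP; rewrite eq_le !leNgt.
by apply/andP; split; apply/negP => /ltn_rank; rewrite e ltnn.
Qed.

Lemma leq_block s s' : (val s <= val s')%R -> block s <= block s'.
Proof. by move=> /leq_rank le; exact: leq_div2r. Qed.

Lemma block_le d s : #|T| <= d -> block s <= d %/ w.
Proof. by move=> le; apply: leq_div2r; apply: leq_trans (max_card _) le. Qed.

(** Inside a block the injective [rank] is determined by its remainder modulo [w]. *)
Lemma card_block c : 0 < w -> #|[set s | block s == c]| <= w.
Proof.
move=> w_gt0; pose f s := Ordinal (ltn_pmod (rank s) w_gt0).
rewrite -[X in _ <= X]card_ord -(@card_in_imset _ _ f); first exact: max_card.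
move=> s s'; rewrite !inE => /eqP bs /eqP bs' [e]; apply: rank_inj.
by rewrite (divn_eq (rank s) w) (divn_eq (rank s') w) e -/(block s) bs -bs'.
Qed.

End Blocks.

(* On a chain of the grid, a block is determined by the sum of its two
   coordinates; for an antichain one coordinate is first reversed. *)
Definition chain_key (I : Type) (t : nat) (s s' : I -> bool) (f g : I -> nat)
    (i : I) : bool * bool * 'I_(2 * t).+1 :=
  (s i, s' i, inord (f i + if s i == s' i then g i else t - g i)).

(** The signs [s] and [s'] sort the points of a curve into four monotone pieces, increasing where
    the signs agree and decreasing where they differ. *)
Definition chains (I : finType) (s s' : I -> bool) (f g : I -> nat)
    (S : {set I}) : Prop :=
  forall i j, i \in S -> j \in S -> s i = s j -> s' i = s' j ->
    (f i <= f j) && (if s i == s' i then g i <= g j else g j <= g i) ||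
    (f j <= f i) && (if s i == s' i then g j <= g i else g i <= g j).

(** Comparable grid positions with equal coordinate sums coincide. The bounds by [t] keep [t - g i]
    from being truncated and the sum at most [2 * t], where [inord] is faithful. *)
Lemma chain_key_inj (I : finType) (t : nat) (s s' : I -> bool) (f g : I -> nat)
    (S : {set I}) (fS : forall i, f i <= t) (gS : forall i, g i <= t) :
  chains s s' f g S ->
  forall i j, i \in S -> j \in S ->
    chain_key t s s' f g i = chain_key t s s' f g j -> f i = f j /\ g i = g j.
Proof.
move=> ch i j iS jS [es es' /(congr1 val)].
move: (ch i j iS jS es es') (fS i) (fS j) (gS i) (gS j); rewrite -es -es'.
by case: ifP => _ ? ? ? ? ?; rewrite /= !inordK; lia.
Qed.

Lemma card_chain_key t : #|{: bool * bool * 'I_(2 * t).+1}| = 4 * (2 * t).+1.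
Proof. by rewrite !card_prod card_bool card_ord. Qed.

Lemma leq_card_chains_pairs (I : finType) (t : nat) (s s' : I -> bool)
    (f g : I -> nat) (S : {set I}) :
  (forall i, f i <= t) -> (forall i, g i <= t) -> chains s s' f g S ->
  #|S| <= 4 * (2 * t).+1 + #|[set p : I * I |
    [&& p.1 \in S, p.2 \in S, p.1 != p.2, f p.1 == f p.2 & g p.1 == g p.2]]|.
Proof.
move=> ft gt ch.
rewrite -card_chain_key; apply: leq_trans (leq_card_pairs (chain_key t s s' f g) _) _.
rewrite leq_add2l; apply/subset_leq_card/fintype.subsetP => -[i j]; rewrite !inE /=.
move=> /and4P[iS jS -> /eqP e].
by have [-> ->] := chain_key_inj ft gt ch iS jS e; rewrite iS jS !eqxx.
Qed.

Lemma leq_card_chains_triples (I : finType) (t : nat) (s s' : I -> bool)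
    (f g : I -> nat) (S : {set I}) :
  (forall i, f i <= t) -> (forall i, g i <= t) -> chains s s' f g S ->
  #|S| <= 2 * (4 * (2 * t).+1) + #|[set p : I * I * I |
    [&& [&& p.1.1 \in S, p.1.2 \in S & p.2 \in S],
        [&& p.1.1 != p.1.2, p.1.1 != p.2 & p.1.2 != p.2],
        (f p.1.1 == f p.1.2) && (g p.1.1 == g p.1.2) &
        (f p.1.1 == f p.2) && (g p.1.1 == g p.2)]]|.
Proof.
move=> ft gt ch.
rewrite -card_chain_key; apply: leq_trans (leq_card_triples (chain_key t s s' f g) _) _.
rewrite leq_add2l; apply/subset_leq_card/fintype.subsetP => -[[i j] l]; rewrite !inE /=.
move=> /and4P[/and3P[iS jS lS] -> /eqP e /eqP e'].
have [-> ->] := chain_key_inj ft gt ch iS jS e.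
have [<- <-] := chain_key_inj ft gt ch iS lS e'.
have [-> ->] := chain_key_inj ft gt ch iS jS e.
by rewrite iS jS lS !eqxx.
Qed.

Lemma sum_card_sets (C P : finType) (S : C -> {set P}) :
  \sum_c #|S c| = #|[set z : C * P | z.2 \in S z.1]|.
Proof.
rewrite (sum_card_fibers (fun z => z.1)); apply: eq_bigr => c _.
have inj : injective (fun p : P => (c, p)) by move=> ? ? [].
rewrite -(card_imset _ inj); apply: eq_card => -[c' p].
rewrite !inE /=; apply/imsetP/andP => [[p' Sp' [-> ->]]|[Sp /eqP e]].
  by rewrite eqxx.
by exists p; rewrite -?e.
Qed.

Lemma leq_card_rel (T T' : finType) (e : T -> T' -> bool) (w : nat) :
  (forall s, #|[set s' | e s s']| <= w) ->
  #|[set p : T * T' | e p.1 p.2]| <= #|T| * w.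
Proof.
move=> le; rewrite (sum_card_fibers (fun p => p.1)) -sum_nat_const.
apply: leq_sum => s _; apply: leq_trans (le s).
have inj : injective (fun s' : T' => (s, s')) by move=> ? ? [].
rewrite -(card_imset _ inj); apply/subset_leq_card/fintype.subsetP => -[r r'].
rewrite !inE /= => /andP[err' /eqP ers]; rewrite ers in err' *.
by apply/imsetP; exists r'; rewrite ?inE.
Qed.

Lemma leq_card_block_pair (R : realDomainType) (U V : finType) (u : U -> R)
    (v : V -> R) (w m n : nat) :
  injective u -> injective v -> 0 < w ->
  #|[set p : U * V | (m == block u w p.1) && (n == block v w p.2)]| <= w ^ 2.
Proof.
move=> u_inj v_inj w_gt0.
apply: leq_trans (leq_mul (card_block u_inj m w_gt0) (card_block v_inj n w_gt0)).
rewrite -cardsX; apply/subset_leq_card/fintype.subsetP => -[a b].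
by rewrite !inE /= => /andP[/eqP-> /eqP->]; rewrite !eqxx.
Qed.

(* This block width makes a curve meet at most [m / 2] blocks. *)
Lemma column_arith (k m d w : nat) :
  64 <= m -> m <= d -> w = (32 * d) %/ m + 1 ->
  k * m ^ 2 <= k * m * (4 * (2 * (d %/ w)).+1) + d ^ 2 * w ^ 2 ->
  k * m ^ 4 <= 2178 * d ^ 4.
Proof.
move=> m64 md ew le.
have m_gt0 : 0 < m by lia.
have wm_ge : 32 * d <= w * m.
  by rewrite ew mulnDl mul1n {1}(divn_eq (32 * d) m) leq_add2l ltnW // ltn_pmod.
(* Rounding adds at most [m <= d] to [32 * d]. Squaring this bound produces the constant
   [2178 = 2 * 33 ^ 2]. *)
have wm_le : w * m <= 33 * d.
  by rewrite ew mulnDl mul1n; have := leq_divM (32 * d) m; lia.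
have w_gt0 : 0 < w by rewrite ew addn1.
set t := d %/ w in le *.
have tm : 32 * t <= m.
  rewrite -(leq_pmul2r w_gt0) (mulnC m) -mulnA.
  by apply: leq_trans wm_ge; rewrite leq_mul2l leq_divM orbT.
have t_le : 2 * (4 * (2 * t).+1) <= m by lia.
have le1 : 2 * (k * m * (4 * (2 * t).+1)) <= k * m ^ 2.
  by rewrite mulnCA -mulnn (mulnA k) leq_mul2l t_le orbT.
have le2 : k * m ^ 2 <= 2 * (d ^ 2 * w ^ 2) by lia.
have -> : k * m ^ 4 = k * m ^ 2 * m ^ 2 by rewrite -mulnA -expnD.
apply: leq_trans (leq_mul le2 (leqnn (m ^ 2))) _.
have -> : 2 * (d ^ 2 * w ^ 2) * m ^ 2 = 2 * d ^ 2 * (w * m) ^ 2.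
  by rewrite expnMn !mulnA.
have -> : 2178 * d ^ 4 = 2 * d ^ 2 * (33 * d) ^ 2 by rewrite expnMn; lia.
by rewrite leq_mul2l leq_exp2r // wm_le orbT.
Qed.

(* This block width makes the terms without [k] add up to at most half of the
   left-hand side. *)
Lemma energy_arith (k m n d w : nat) :
  0 < m -> m <= d -> 64 * d <= m ^ 2 -> 8 * d <= n ->
  k * m ^ 4 <= 2178 * d ^ 4 -> w = (128 * d) %/ m + 1 ->
  (m * n) ^ 2 <= d * (2 * m ^ 2 * n + (n ^ 2 * (2 * (4 * (2 * (m %/ w)).+1)) +
     m ^ 2 * w ^ 4 * k)) ->
  n ^ 2 * m ^ 8 <= 2 * 129 ^ 4 * 2178 * d ^ 9.
Proof.
move=> m_gt0 md dm dn km ew.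
have wm_ge : 128 * d <= w * m.
  by rewrite ew mulnDl mul1n {1}(divn_eq (128 * d) m) leq_add2l ltnW // ltn_pmod.
have wm_le : w * m <= 129 * d.
  by rewrite ew mulnDl mul1n; have := leq_divM (128 * d) m; lia.
set t := m %/ w => le.
have dt : 128 * (d * t) <= m ^ 2.
  rewrite mulnA; apply: leq_trans (leq_mul wm_ge (leqnn t)) _.
  by rewrite mulnC mulnA -mulnn leq_mul2r leq_divM orbT.
have le1 : 4 * (d * (2 * m ^ 2 * n)) <= (m * n) ^ 2.
  have -> : 4 * (d * (2 * m ^ 2 * n)) = m ^ 2 * n * (8 * d) by lia.
  by rewrite expnMn -(mulnn n) (mulnA (m ^ 2)) leq_mul2l dn orbT.
have le2 : 4 * (d * (n ^ 2 * (2 * (4 * (2 * t).+1)))) <= (m * n) ^ 2.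
  have -> : 4 * (d * (n ^ 2 * (2 * (4 * (2 * t).+1)))) =
     (64 * (d * t) + 32 * d) * n ^ 2 by lia.
  by rewrite expnMn leq_mul2r; apply/orP; right; move: dt dm; clear; lia.
have le3 : (m * n) ^ 2 <= 2 * (d * (m ^ 2 * w ^ 4 * k)).
  move: le le1 le2; rewrite !mulnDr; clear.
  by move: (d * _) (d * _) (d * _) => e1 e2 e3; lia.
have le4 : n ^ 2 <= 2 * d * (w ^ 4 * k).
  rewrite -(@leq_pmul2l (m ^ 2)) ?expn_gt0 ?m_gt0 // -expnMn.
  by apply: leq_trans le3 _; apply: eq_leq; lia.
apply: leq_trans (leq_mul le4 (leqnn (m ^ 8))) _.
(* Half of [m ^ 8] is absorbed by the block width, the other half by the column bound on [k]. *)
have -> : 2 * d * (w ^ 4 * k) * m ^ 8 = 2 * d * ((w * m) ^ 4 * (k * m ^ 4)).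
  by rewrite expnMn (expnD m 4 4); lia.
have -> : 2 * 129 ^ 4 * 2178 * d ^ 9 = 2 * d * ((129 * d) ^ 4 * (2178 * d ^ 4)).
  by rewrite expnMn (expnD d 1 8) (expnD d 4 4); clear; move: 129 2178; lia.
by rewrite leq_mul2l leq_mul ?orbT // leq_exp2r.
Qed.

Local Open Scope ring_scope.

(** * Points in a column *)

Lemma ler_sqrB_ge (R : realDomainType) (x a b : R) :
  x <= a -> x <= b -> ((a - x) ^+ 2 <= (b - x) ^+ 2) = (a <= b).
Proof. by move=> xa xb; rewrite ler_sqr ?nnegrE ?subr_ge0 // lerD2r. Qed.

Lemma ler_sqrB_le (R : realDomainType) (x a b : R) :
  a < x -> b < x -> ((a - x) ^+ 2 <= (b - x) ^+ 2) = (b <= a).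
Proof.
move=> ax bx; rewrite -(opprB x a) -(opprB x b) !sqrrN.
by rewrite ler_sqr ?nnegrE ?subr_ge0 ?(ltW ax) ?(ltW bx) // lerD2l lerN2.
Qed.

Lemma column_bound (R : realDomainType) (A Y U V : finType)
    (al : A -> R) (et : Y -> R) (u : U -> R) (v : V -> R)
    (du : A -> A -> U) (dv : A -> Y -> V) (x : R) (w d : nat) :
  injective al -> injective et -> injective u -> injective v ->
  (forall y, 0 < et y) ->
  (forall a b, u (du a b) = al a - al b) ->
  (forall a y, v (dv a y) = (al a - x) ^+ 2 + et y ^+ 2) ->
  (0 < w)%N -> (#|U| <= d)%N -> (#|V| <= d)%N ->
  (#|Y| * #|A| ^ 2 <=
     #|Y| * #|A| * (4 * (2 * (d %/ w)).+1) + d ^ 2 * w ^ 2)%N.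
Proof.
move=> al_inj et_inj u_inj v_inj et_gt0 duE dvE w_gt0 Ud Vd.
set t := (d %/ w)%N.
pose f (c : A * Y) a := block u w (du a c.1).
pose g (c : A * Y) a := block v w (dv a c.2).
pose S (c : A * Y) := [set p : A * A | [&& p.1 \in setT, p.2 \in setT,
  p.1 != p.2, f c p.1 == f c p.2 & g c p.1 == g c p.2]].
have curve c : (#|A| <= 4 * (2 * t).+1 + #|S c|)%N.
  (* A parabola has only two monotone branches, so the second sign is constant. *)
  rewrite -cardsT; apply: (@leq_card_chains_pairs _ _ (fun a => x <= al a)
    (fun=> true)) => [a|a|a b _ _ + _]; try exact: block_le.
  have fE a' b' : al a' <= al b' -> (f c a' <= f c b')%N.
    by move=> le; apply: leq_block; rewrite !duE lerD2r.
  have gE a' b' : (al a' - x) ^+ 2 <= (al b' - x) ^+ 2 -> (g c a' <= g c b')%N.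
    by move=> le; apply: leq_block; rewrite !dvE lerD2r.
  have [xa|ax] := leP x (al a); have [xb|bx] := leP x (al b) => //= _.
    have [le|/ltW le] := leP (al a) (al b); [apply/orP; left|apply/orP; right];
      by rewrite fE ?gE // ler_sqrB_ge.
  have [le|/ltW le] := leP (al a) (al b); [apply/orP; left|apply/orP; right];
    by rewrite fE ?gE // ler_sqrB_le.
have sumS : (\sum_c #|S c| <= d ^ 2 * w ^ 2)%N.
  pose X := [set z : (A * Y) * (A * A) | z.2 \in S z.1].
  rewrite sum_card_sets -/X.
  pose W := [set p : (U * V) * (U * V) |
    (block u w p.1.1 == block u w p.2.1) && (block v w p.1.2 == block v w p.2.2)].
  have leW : (#|W| <= d ^ 2 * w ^ 2)%N.
    apply: leq_trans (leq_card_rel (e := fun s s' : U * V =>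
      (block u w s.1 == block u w s'.1) && (block v w s.2 == block v w s'.2)) _) _.
      by move=> s; apply: leq_card_block_pair.
    by rewrite leq_mul2r card_prod leq_mul ?orbT.
  apply: leq_trans leW.
  pose F (z : (A * Y) * (A * A)) := ((du z.2.1 z.1.1, dv z.2.1 z.1.2),
                                    (du z.2.2 z.1.1, dv z.2.2 z.1.2)).
  rewrite -(@card_in_imset _ _ F X).
    apply/subset_leq_card/fintype.subsetP => _ /imsetP[[c [a a']] + ->].
    by rewrite !inE /= => /andP[_].
  move=> [[b y] [a1 a2]] [[b' y'] [a1' a2']]; rewrite !inE /=.
  move=> /andP[na _] _ [].
  move=> /(congr1 u) + /(congr1 v) + /(congr1 u) + /(congr1 v).
  rewrite !duE !dvE => e1 e2 e3 e4.
  (* Two points determine the parabola: their first coordinates give [al a1 - al a2], and their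
     second coordinates differ by this times [al a1 + al a2 - 2 * x]. Hence the sum is known too,
     then [b], then [y] by positivity. *)
  have na' : al a1 - al a2 != 0 by rewrite subr_eq0 (inj_eq al_inj).
  have ea : al a1 = al a1'.
    have e5 : al a2' = al a1' - (al a1 - al a2) by lra.
    have : (al a1 - al a2) * (al a1 + al a2) = (al a1 - al a2) * (al a1' + al a2').
      by move: e2 e4; rewrite e5; lra.
    by move=> /(mulfI na'); lra.
  have eb : al b = al b' by lra.
  have ea2 : al a2 = al a2' by lra.
  have ey : et y = et y'.
    apply/eqP; rewrite -(eqrXn2 (n := 2)) // ?ltW //; apply/eqP.
    by move: e2; rewrite ea; lra.
  by rewrite (al_inj _ _ ea) (al_inj _ _ eb) (al_inj _ _ ea2) (et_inj _ _ ey).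
have -> : (#|Y| * #|A| ^ 2 = \sum_(c : A * Y) #|A|)%N.
  by rewrite sum_nat_const card_prod; lia.
apply: leq_trans (_ : _ <= \sum_(c : A * Y) (4 * (2 * t).+1 + #|S c|))%N _.
  by apply: leq_sum.
by rewrite big_split /= sum_nat_const card_prod (mulnC #|A|) leq_add2l.
Qed.

(** * Energy *)

(* Each chord of a line on the hyperbola [X^2 - Z^2 = g] has its direction
   orthogonal, for this quadratic form, to its midpoint; two chords on the same
   line then force the line to be isotropic. *)
Lemma hyperbola_line (R : realDomainType) (g p q r X1 Z1 X2 Z2 X3 Z3 : R) :
  g != 0 -> q != 0 ->
  X1 ^+ 2 - Z1 ^+ 2 = g -> X2 ^+ 2 - Z2 ^+ 2 = g -> X3 ^+ 2 - Z3 ^+ 2 = g ->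
  p * X1 + q * Z1 = r -> p * X2 + q * Z2 = r -> p * X3 + q * Z3 = r ->
  (X1, Z1) != (X2, Z2) -> (X1, Z1) != (X3, Z3) -> (X2, Z2) != (X3, Z3) -> False.
Proof.
move=> g0 q0 h1 h2 h3 l1 l2 l3 n12 n13 n23.
have neqX X X' Z Z' : p * X + q * Z = r -> p * X' + q * Z' = r ->
    (X, Z) != (X', Z') -> X - X' != 0.
  move=> l l'; apply: contra_neq => e; have eX : X = X' by lra.
  rewrite eX in l *; congr pair; apply: (mulfI q0); lra.
have chord X X' Z Z' : p * X + q * Z = r -> p * X' + q * Z' = r ->
    X ^+ 2 - Z ^+ 2 = g -> X' ^+ 2 - Z' ^+ 2 = g -> (X, Z) != (X', Z') ->
    q * (X + X') = - p * (Z + Z').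
  move=> l l' h h' n; apply: (mulfI (neqX _ _ _ _ l l' n)).
  have e : p * (X - X') = - (q * (Z - Z')) by lra.
  have -> : (X - X') * (- p * (Z + Z')) = - (p * (X - X')) * (Z + Z') by ring.
  have -> : (X - X') * (q * (X + X')) = q * (X ^+ 2 - X' ^+ 2) by ring.
  have -> : X ^+ 2 - X' ^+ 2 = Z ^+ 2 - Z' ^+ 2 by lra.
  by rewrite e; ring.
have c12 := chord _ _ _ _ l1 l2 h1 h2 n12.
have c13 := chord _ _ _ _ l1 l3 h1 h3 n13.
have X23 := neqX _ _ _ _ l2 l3 n23.
have X12 := neqX _ _ _ _ l1 l2 n12.
have : (q - p) * (q + p) = 0.
  apply: (mulfI X23); rewrite mulr0.
  have e1 : q * (X2 - X3) = - p * (Z2 - Z3) by lra.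
  have e2 : p * (X2 - X3) = - q * (Z2 - Z3) by lra.
  have -> : (X2 - X3) * ((q - p) * (q + p)) =
    q * (q * (X2 - X3)) - p * (p * (X2 - X3)) by ring.
  by rewrite e1 e2; ring.
(* On an isotropic line the chord relation forces [r = 0]; then the line lies in the cone
   [X^2 = Z^2], against [g != 0]. *)
move=> /eqP; rewrite mulf_eq0 => /orP[] /eqP e.
  have ep : p = q by lra.
  rewrite ep in l1 l2 c12.
  have e1 : X1 = - Z1 by apply: (mulfI q0); lra.
  by case/eqP: g0; rewrite -h1 e1; ring.
have ep : p = - q by lra.
rewrite ep in l1 l2 c12.
have e1 : X1 = Z1 by apply: (mulfI q0); lra.
by case/eqP: g0; rewrite -h1 e1; ring.
Qed.

(** The two equations have the same quadratic part, so their difference is linear: if the centres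
    differed, the three points would be collinear. [hyperbola_line] needs a nonzero second
    coefficient, so it is applied once as is and once with the axes swapped and [g] negated. *)
Lemma hyperbola_three_points (R : realDomainType)
    (x x' g y y' h a1 b1 a2 b2 a3 b3 : R) : g != 0 ->
  (a1 - x) ^+ 2 - (b1 - x') ^+ 2 = g -> (a1 - y) ^+ 2 - (b1 - y') ^+ 2 = h ->
  (a2 - x) ^+ 2 - (b2 - x') ^+ 2 = g -> (a2 - y) ^+ 2 - (b2 - y') ^+ 2 = h ->
  (a3 - x) ^+ 2 - (b3 - x') ^+ 2 = g -> (a3 - y) ^+ 2 - (b3 - y') ^+ 2 = h ->
  (a1, b1) != (a2, b2) -> (a1, b1) != (a3, b3) -> (a2, b2) != (a3, b3) ->
  [/\ x = y, x' = y' & g = h].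
Proof.
move=> g0 e1 f1 e2 f2 e3 f3 n12 n13 n23.
have shift (a b c d : R) : (a, b) != (c, d) -> (a - x, b - x') != (c - x, d - x').
  by apply: contra_neq => -[/addIr-> /addIr->].
have shift' (a b c d : R) : (a, b) != (c, d) -> (b - x', a - x) != (d - x', c - x).
  by apply: contra_neq => -[/addIr-> /addIr->].
pose r := h - g - (x - y) ^+ 2 + (x' - y') ^+ 2.
have line a b : (a - x) ^+ 2 - (b - x') ^+ 2 = g ->
    (a - y) ^+ 2 - (b - y') ^+ 2 = h ->
    2 * (x - y) * (a - x) + - 2 * (x' - y') * (b - x') = r.
  by rewrite /r => <- <-; ring.
have exy' : x' = y'.
  apply/eqP; rewrite -subr_eq0; apply: contraT => n.
  have [] := @hyperbola_line R g (2 * (x - y)) (- 2 * (x' - y')) r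
    (a1 - x) (b1 - x') (a2 - x) (b2 - x') (a3 - x) (b3 - x');
    by rewrite ?line ?shift // mulf_neq0 // oppr_eq0 pnatr_eq0.
have exy : x = y.
  apply/eqP; rewrite -subr_eq0; apply: contraT => n.
  have [] := @hyperbola_line R (- g) (- 2 * (x' - y')) (2 * (x - y)) r
    (b1 - x') (a1 - x) (b2 - x') (a2 - x) (b3 - x') (a3 - x);
    by rewrite ?(addrC (- 2 * _ * _)) ?line ?shift' ?oppr_eq0 //
      ?mulf_neq0 ?pnatr_eq0 //; lra.
by split=> //; rewrite -e1 -f1 exy exy'.
Qed.

(** Along the hyperbola the two squares differ by a constant, hence are ordered alike; left of the
    centre, the order of the squares is the reverse of that of the coordinates. *)
Lemma hyperbola_chains (R : realDomainType) (A : finType) (al : A -> R)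
    (x x' g : R) (w : nat) (S : {set A * A}) :
  (forall p, p \in S -> (al p.1 - x) ^+ 2 - (al p.2 - x') ^+ 2 = g) ->
  chains (fun p : A * A => x <= al p.1) (fun p : A * A => x' <= al p.2)
    (fun p => block al w p.1) (fun p => block al w p.2) S.
Proof.
move=> hS [a b] [a' b'] /hS /= e /hS /= e'.
have lt_sqr : ((al a - x) ^+ 2 <= (al a' - x) ^+ 2) =
              ((al b - x') ^+ 2 <= (al b' - x') ^+ 2).
  by apply/idP/idP => ?; lra.
have gt_sqr : ((al a' - x) ^+ 2 <= (al a - x) ^+ 2) =
              ((al b' - x') ^+ 2 <= (al b - x') ^+ 2).
  by apply/idP/idP => ?; lra.
have le := @leq_block R A al w.
have [xa|ax] := leP x (al a); have [xa'|ax'] := leP x (al a') => //= _;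
  [rewrite (ler_sqrB_ge xa xa') in lt_sqr; rewrite (ler_sqrB_ge xa' xa) in gt_sqr
  |rewrite (ler_sqrB_le ax ax') in lt_sqr; rewrite (ler_sqrB_le ax' ax) in gt_sqr];
  (have [xb|bx] := leP x' (al b); have [xb'|bx'] := leP x' (al b') => //= _;
  [rewrite (ler_sqrB_ge xb xb') in lt_sqr; rewrite (ler_sqrB_ge xb' xb) in gt_sqr
  |rewrite (ler_sqrB_le bx bx') in lt_sqr; rewrite (ler_sqrB_le bx' bx) in gt_sqr]);
  have [l|/ltW l] := leP (al a) (al a'); apply/orP; (left + right);
  by rewrite !le // -?lt_sqr -?gt_sqr.
Qed.

Section Energy.
Variables (R : realDomainType) (A Q V : finType) (al : A -> R) (px py : Q -> R).
Variables (v : V -> R) (dv : A -> Q -> V) (k w : nat).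
Hypothesis al_inj : injective al.
Hypothesis pxy_inj : injective (fun q => (px q, py q)).
Hypothesis py_gt0 : forall q, 0 < py q.
Hypothesis dvE : forall a q, v (dv a q) = (al a - px q) ^+ 2 + py q ^+ 2.
Hypothesis column_le : forall x, (#|[set q | px q == x]| <= k)%N.
Hypothesis w_gt0 : (0 < w)%N.

(** The trace on the grid of the hyperbola defined by a pair of points; it degenerates to two lines
    when their heights agree. *)
Let curve (c : Q * Q) := [set p : A * A | dv p.1 c.1 == dv p.2 c.2].

Let curveE c p : p \in curve c ->
  (al p.1 - px c.1) ^+ 2 - (al p.2 - px c.2) ^+ 2 = py c.2 ^+ 2 - py c.1 ^+ 2.
Proof. by rewrite inE => /eqP/(congr1 v); rewrite !dvE; lra. Qed.

Let py_eq q q' : py q ^+ 2 = py q' ^+ 2 -> py q = py q'.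
Proof. by move=> /eqP; rewrite eqrXn2 ?ltW // => /eqP. Qed.

(** Given [a], [q] and [b], the height of the last point is that of [q] and its abscissa is known up
    to reflection in [al b]; the boolean in [F] selects the side. *)
Lemma degenerate_energy :
  (#|[set z : (A * Q) * (A * Q) | (dv z.1.1 z.1.2 == dv z.2.1 z.2.2) &&
      (py z.1.2 == py z.2.2)]| <= 2 * #|A| ^ 2 * #|Q|)%N.
Proof.
pose F (z : (A * Q) * (A * Q)) := (z.1, z.2.1, px z.2.2 <= al z.2.1).
have -> : (2 * #|A| ^ 2 * #|Q| = #|{: A * Q * A * bool}|)%N.
  by rewrite !card_prod card_bool; lia.
rewrite -(@card_in_imset _ _ F) ?max_card //.
move=> [[a q] [b r]] [[a' q'] [b' r']]; rewrite !inE /=.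
move=> /andP[/eqP e /eqP f] /andP[/eqP e' /eqP f'] [ea eq eb es]; subst a' q' b'.
suff -> : r = r' by [].
apply: pxy_inj; rewrite -f -f'; congr pair.
have : dv b r = dv b r' by rewrite -e.
move=> /(congr1 v); rewrite !dvE -f -f' => /addIr /eqP; rewrite eqf_sqr.
move=> /orP[] /eqP; first by lra.
by move: es; case: (leP (px r)); case: (leP (px r')) => //; lra.
Qed.

(** All these hyperbolas have the same centre and constant. So the first point of the pair lies in a
    fixed column, and it determines the second one. *)
Lemma curves_three_points (p1 p2 p3 : A * A) :
  p1 != p2 -> p1 != p3 -> p2 != p3 ->
  (#|[set c : Q * Q | [&& py c.1 != py c.2, p1 \in curve c, p2 \in curve c
       & p3 \in curve c]]| <= k)%N.
Proof.
move=> n12 n13 n23; set S := [set c | _].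
have [->|[c0 c0S]] := set_0Vmem S; first by rewrite cards0.
have al2 (p p' : A * A) : p != p' -> (al p.1, al p.2) != (al p'.1, al p'.2).
  case: p p' => [a b] [a' b'] /=; apply: contra_neq.
  by move=> -[/al_inj-> /al_inj->].
have same c c' : c \in S -> c' \in S -> [/\ px c.1 = px c'.1, px c.2 = px c'.2 &
    py c.2 ^+ 2 - py c.1 ^+ 2 = py c'.2 ^+ 2 - py c'.1 ^+ 2].
  rewrite in_set => /and4P[n /curveE h1 /curveE h2 /curveE h3].
  rewrite in_set => /and4P[_ /curveE h1' /curveE h2' /curveE h3'].
  apply: hyperbola_three_points h1 h1' h2 h2' h3 h3' _ _ _; try exact: al2.
  by rewrite subr_eq0; apply: contra_neq n => /py_eq.
apply: leq_trans (column_le (px c0.1)).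
rewrite -(@card_in_imset _ _ (fun c => c.1) S).
  apply/subset_leq_card/fintype.subsetP => _ /imsetP[c cS ->].
  by have [e _ _] := same c c0 cS c0S; rewrite inE e.
move=> [q r] [q' r'] qrS qrS' /= eq; subst q'.
have [_ /= ex ey] := same _ _ qrS qrS'.
congr pair; apply: pxy_inj; rewrite ex; congr pair.
by apply: py_eq; move/addIr: ey.
Qed.

Lemma nondegenerate_energy :
  (#|[set z : (A * Q) * (A * Q) | (dv z.1.1 z.1.2 == dv z.2.1 z.2.2) &&
      (py z.1.2 != py z.2.2)]| <=
   #|Q| ^ 2 * (2 * (4 * (2 * (#|A| %/ w)).+1)) + #|A| ^ 2 * w ^ 4 * k)%N.
Proof.
set t := (#|A| %/ w)%N.
pose f (p : A * A) := block al w p.1; pose g (p : A * A) := block al w p.2.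
pose ok (c : Q * Q) := py c.1 != py c.2.
pose T (c : Q * Q) := if ok c then [set p : (A * A) * (A * A) * (A * A) |
    [&& [&& p.1.1 \in curve c, p.1.2 \in curve c & p.2 \in curve c],
        [&& p.1.1 != p.1.2, p.1.1 != p.2 & p.1.2 != p.2],
        (f p.1.1 == f p.1.2) && (g p.1.1 == g p.1.2) &
        (f p.1.1 == f p.2) && (g p.1.1 == g p.2)]] else set0.
pose S (c : Q * Q) := if ok c then curve c else set0.
have leS c : (#|S c| <= 2 * (4 * (2 * t).+1) + #|T c|)%N.
  rewrite /S /T; case: ifP => _; last by rewrite cards0.
  by apply: (leq_card_chains_triples _ _ (hyperbola_chains w (@curveE c))) => p;
     exact: block_le.
have sumT : (\sum_c #|T c| <= #|A| ^ 2 * w ^ 4 * k)%N.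
  (* The first point fixes the block, which leaves at most [w ^ 2] choices for each of the other
     two. *)
  pose B := [set p : (A * A) * ((A * A) * (A * A)) |
    [&& p.1 != p.2.1, p.1 != p.2.2, p.2.1 != p.2.2,
        (f p.1 == f p.2.1) && (g p.1 == g p.2.1) &
        (f p.1 == f p.2.2) && (g p.1 == g p.2.2)]].
  have leB : (#|B| <= #|A| ^ 2 * w ^ 4)%N.
    apply: leq_trans (leq_card_rel (e := fun s (p : (A * A) * (A * A)) =>
      [&& s != p.1, s != p.2, p.1 != p.2,
        (f s == f p.1) && (g s == g p.1) & (f s == f p.2) && (g s == g p.2)])
      (w := w ^ 4) _) _; last by rewrite card_prod.
    move=> s; have le := leq_card_block_pair (f s) (g s) al_inj al_inj w_gt0.
    have -> : (w ^ 4 = w ^ 2 * w ^ 2)%N by rewrite -expnD.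
    apply: leq_trans (leq_mul le le); rewrite -cardsX.
    apply/subset_leq_card/fintype.subsetP => -[p p']; rewrite !inE /=.
    by move=> /and5P[_ _ _ -> ->].
  pose Z := [set z : {x in B} * (Q * Q) | [&& ok z.2,
    (val z.1).1 \in curve z.2, (val z.1).2.1 \in curve z.2 &
    (val z.1).2.2 \in curve z.2]].
  have leZ : (#|Z| <= #|A| ^ 2 * w ^ 4 * k)%N.
    apply: leq_trans (leq_card_rel (e := fun (s : {x in B}) c => [&& ok c,
      (val s).1 \in curve c, (val s).2.1 \in curve c &
      (val s).2.2 \in curve c]) (w := k) _) _.
      move=> [[p1 [p2 p3]] /= ]; rewrite inE /= => /and5P[n12 n13 n23 _ _].
      exact: curves_three_points.
    by rewrite leq_mul2r card_sig leB orbT.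
  apply: leq_trans leZ; rewrite sum_card_sets.
  pose F (z : {x in B} * (Q * Q)) := (z.2, ((val z.1).1, (val z.1).2.1, (val z.1).2.2)).
  apply: leq_trans (leq_imset_card F Z).
  apply/subset_leq_card/fintype.subsetP => -[c [[p1 p2] p3]].
  rewrite inE /T /=; case: ifP => okc; last by rewrite inE.
  rewrite in_set /= => /and4P[/and3P[c1 c2 c3] /and3P[n12 n13 n23] e2 e3].
  have pB : (p1, (p2, p3)) \in B by rewrite in_set /= n12 n13 n23 e2 e3.
  apply/imsetP; exists (exist (fun s => s \in B) _ pB, c) => //.
  by rewrite in_set /= okc c1 c2 c3.
have -> : (#|[set z : (A * Q) * (A * Q) | (dv z.1.1 z.1.2 == dv z.2.1 z.2.2) &&
    (py z.1.2 != py z.2.2)]| = \sum_c #|S c|)%N.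
  rewrite sum_card_sets.
  pose F (z : (A * Q) * (A * Q)) := ((z.1.2, z.2.2), (z.1.1, z.2.1)).
  have F_inj : injective F by move=> [[? ?] [? ?]] [[? ?] [? ?]] [-> -> -> ->].
  rewrite -(card_imset _ F_inj); apply: eq_card => -[[q r] [a b]].
  rewrite !inE /= /S; apply/imsetP/idP => [[[[a' q'] [b' r']]]|].
    by rewrite !inE /= => /andP[e n] [-> -> -> ->]; rewrite /ok /= n !inE.
  rewrite /ok /=; case: ifP => n; rewrite inE // => e.
  by exists ((a, q), (b, r)) => //; rewrite !inE /= e n.
apply: leq_trans (_ : _ <= \sum_c (2 * (4 * (2 * t).+1) + #|T c|))%N _.
  by apply: leq_sum.
by rewrite big_split /= sum_nat_const card_prod mulnn leq_add2l.
Qed.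

Lemma energy_bound :
  ((#|A| * #|Q|) ^ 2 <= #|V| * (2 * #|A| ^ 2 * #|Q| +
     (#|Q| ^ 2 * (2 * (4 * (2 * (#|A| %/ w)).+1)) + #|A| ^ 2 * w ^ 4 * k)))%N.
Proof.
rewrite -card_prod.
apply: leq_trans (collision_Cauchy_Schwarz (fun z : A * Q => dv z.1 z.2)) _.
rewrite leq_mul2l; apply/orP; right.
apply: leq_trans (leq_add degenerate_energy nondegenerate_energy).
apply: leq_trans (leq_card_setU _ _).
apply/subset_leq_card/fintype.subsetP => z; rewrite !inE => ->.
by case: eqP.
Qed.

End Energy.

Lemma heavy_line_bound (R : realDomainType) (A Q U V : finType)
    (al : A -> R) (px py : Q -> R) (u : U -> R) (v : V -> R)
    (du : A -> A -> U) (dv : A -> Q -> V) (d : nat) :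
  injective al -> injective (fun q => (px q, py q)) -> injective u -> injective v ->
  (forall q, 0 < py q) ->
  (forall a b, u (du a b) = al a - al b) ->
  (forall a q, v (dv a q) = (al a - px q) ^+ 2 + py q ^+ 2) ->
  (#|U| <= d)%N -> (#|V| <= d)%N ->
  (0 < #|A|)%N -> (64 * d <= #|A| ^ 2)%N -> (8 * d <= #|Q|)%N ->
  (#|Q| ^ 2 * #|A| ^ 8 <= 2 * 129 ^ 4 * 2178 * d ^ 9)%N.
Proof.
move=> al_inj pxy_inj u_inj v_inj py_gt0 duE dvE Ud Vd m_gt0 dm dn.
have md : (#|A| <= d)%N.
  have /card_gt0P[a0 _] := m_gt0.
  apply: leq_trans Ud; rewrite -(@card_imset _ _ (du^~ a0)) ?max_card //.
  by move=> a b /(congr1 u); rewrite !duE => /addIr/al_inj.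
have m64 : (64 <= #|A|)%N by move: dm md m_gt0; nia.
(* The largest integer that [energy_arith] admits; column sizes being integers, rounding down loses
   nothing. *)
set k := (2178 * d ^ 4 %/ #|A| ^ 4)%N.
have m4 : (0 < #|A| ^ 4)%N by rewrite expn_gt0 m_gt0.
have column x : (#|[set q | px q == x]| <= k)%N.
  rewrite leq_divRL //; apply: column_arith m64 md erefl _.
  have -> : #|[set q | px q == x]| = #|{: {q | px q == x}}|.
    by rewrite card_sig; apply: eq_card => q; rewrite inE.
  apply: (@column_bound R A _ U V al (fun q => py (val q)) u v du
    (fun a q => dv a (val q)) x) => //.
  - move=> [q qx] [r rx] /= e; apply: val_inj; apply: pxy_inj => /=.
    by rewrite e (eqP qx) (eqP rx).
  - by move=> a [q /= /eqP <-].
  - by rewrite addn1.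
apply: (@energy_arith k _ _ d _ m_gt0 md dm dn (leq_divM _ _) erefl).
apply: leq_trans (energy_bound al_inj pxy_inj py_gt0 dvE column (w := ((128 * d) %/ #|A| + 1)%N) _) _.
  by rewrite addn1.
by rewrite leq_mul2r Vd orbT.
Qed.

(** * Lines in the plane *)

From mathcomp Require Import all_classical all_reals all_analysis.

Import numFieldNormedType.Exports.

Local Open Scope classical_set_scope.
Local Open Scope fset_scope.
Local Open Scope ring_scope.

Section LineFrame.
Variables (R : realType) (a b c : R).
Hypothesis ab_neq0 : (a, b) <> (0, 0).

(* Up to the common factor [sqrt (a^2 + b^2)], these are orthonormal coordinates
   in which the line [a x + b y = c] is the horizontal axis. *)
Definition along (p : R * R) : R := a * p.2 - b * p.1.
Definition above (p : R * R) : R := a * p.1 + b * p.2 - c.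

Let s2 := a ^+ 2 + b ^+ 2.

Let s2_gt0 : 0 < s2.
Proof.
rewrite lt_def addr_ge0 ?sqr_ge0 // andbT paddr_eq0 ?sqr_ge0 // !sqrf_eq0.
by apply/negP => /andP[/eqP a0 /eqP b0]; apply: ab_neq0; rewrite a0 b0.
Qed.

Lemma frame_inj : injective (fun p => (along p, above p)).
Proof.
move=> [x y] [x' y'] [/= h1 h2]; have s2_neq0 := lt0r_neq0 s2_gt0.
congr pair; apply: (mulfI s2_neq0); rewrite /s2; rewrite /along /above /= in h1 h2.
  have -> : (a ^+ 2 + b ^+ 2) * x =
    a * (a * x + b * y - c) - b * (a * y - b * x) + a * c by ring.
  by rewrite h1 h2; ring.
have -> : (a ^+ 2 + b ^+ 2) * y =
  b * (a * x + b * y - c) + a * (a * y - b * x) + b * c by ring.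
by rewrite h1 h2; ring.
Qed.

Lemma frame_dist p q :
  (along p - along q) ^+ 2 + (above p - above q) ^+ 2 =
  s2 * euclidean_dist p q ^+ 2.
Proof.
rewrite sqr_sqrtr ?addr_ge0 ?sqr_ge0 // /along /above /s2; ring.
Qed.

Lemma dist_in_distances (P : {fset R * R}) p q :
  p \in P -> q \in P -> p != q -> euclidean_dist p q \in distances P.
Proof.
by move=> pP qP pq; apply/imfset2P; exists p => //; exists q; rewrite ?inE ?qP.
Qed.

Definition line_points (P : {fset R * R}) : {fset R * R} :=
  [fset p in P | above p == 0].

(** On the line a difference of abscissas is a scaled distance up to sign, or 0 for equal points;
    hence the bound [2 * D + 1]. *)
Definition frame_differences (P : {fset R * R}) : {fset R} :=
  [fset Num.sqrt s2 * r | r in distances P] `|`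
  [fset - (Num.sqrt s2 * r) | r in distances P] `|` [fset 0].

Definition frame_sq_distances (P : {fset R * R}) : {fset R} :=
  [fset s2 * r ^+ 2 | r in distances P].

Lemma card_frame_differences P :
  (#|` frame_differences P| <= 2 * num_distances P + 1)%N.
Proof.
rewrite !cardfsU cardfs1; apply: leq_trans (leq_subr _ _) _.
rewrite leq_add2r; apply: leq_trans (leq_subr _ _) _.
by rewrite mul2n -addnn leq_add // leq_imfset_card.
Qed.

Lemma card_frame_sq_distances P :
  (#|` frame_sq_distances P| <= num_distances P)%N.
Proof. exact: leq_imfset_card. Qed.

Lemma frame_differencesP P p q : p \in line_points P -> q \in line_points P ->
  along p - along q \in frame_differences P.
Proof.
rewrite !inE /= => /andP[pP /eqP p0] /andP[qP /eqP q0].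
have [->|pq] := eqVneq p q; first by rewrite subrr eqxx orbT.
have dP := dist_in_distances pP qP pq.
have := frame_dist p q; rewrite p0 q0 subrr expr0n addr0.
rewrite -[in RHS](sqr_sqrtr (ltW s2_gt0)) -exprMn => /eqP; rewrite eqf_sqr.
move=> /orP[] /eqP ->; apply/orP; left; apply/orP; [left|right].
  by apply/imfsetP; exists (euclidean_dist p q).
by apply/imfsetP; exists (euclidean_dist p q).
Qed.

Lemma frame_sq_distancesP P p q : p \in line_points P -> q \in P -> above q != 0 ->
  (along p - along q) ^+ 2 + above q ^+ 2 \in frame_sq_distances P.
Proof.
rewrite !inE /= => /andP[pP /eqP p0] qP q0; apply/imfsetP => /=.
exists (euclidean_dist p q); last by rewrite -frame_dist p0 sub0r sqrrN.
by apply: dist_in_distances => //; apply: contra_neq q0 => <-.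
Qed.

End LineFrame.

(** * Bounds for a half plane and for the plane *)

Lemma line_points_along_inj (R : realType) (a b c : R) (P : {fset R * R}) :
  (a, b) <> (0, 0) -> {in line_points a b c P &, injective (along a b)}.
Proof.
move=> ab p q; rewrite !inE /= => /andP[_ /eqP p0] /andP[_ /eqP q0] e.
by apply: (frame_inj (c := c) ab); rewrite e p0 q0.
Qed.

Lemma card_line_points_le (R : realType) (a b c : R) (P : {fset R * R}) :
  (a, b) <> (0, 0) -> (#|` line_points a b c P| <= 2 * num_distances P + 1)%N.
Proof.
move=> ab; have [->|[p0 p0L]] := fset_0Vmem (line_points a b c P).
  by rewrite cardfs0.
apply: leq_trans (card_frame_differences a b P).
pose shift p := along a b p - along a b p0.
have <- : #|` [fset shift p | p in line_points a b c P]| = #|` line_points a b c P|.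
  apply: card_in_imfset => p q pL qL /addIr.
  exact: (line_points_along_inj ab pL qL).
apply/fsubset_leq_card/fsubsetP => _ /imfsetP[p /= pL ->].
exact: (frame_differencesP ab pL p0L).
Qed.

(** On one side of the line [above] is positive, hence determined by its square, as
    [heavy_line_bound] requires. *)
Lemma half_plane_bound (R : realType) (a b c : R) (P : {fset R * R}) :
  let m := #|` line_points a b c P| in
  let d := (2 * num_distances P + 1)%N in
  let N := #|` [fset p in P | 0 < above a b c p]| in
  (a, b) <> (0, 0) -> (0 < m)%N -> (64 * d <= m ^ 2)%N -> (8 * d <= N)%N ->
  (N ^ 2 * m ^ 8 <= 2 * 129 ^ 4 * 2178 * d ^ 9)%N.
Proof.
move=> m d N ab; rewrite /m /N !cardfE.
set L := line_points a b c P; set Q := [fset p in P | _] => m_gt0 dm dN.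
have QP (q : Q) : val q \in P by have := valP q; rewrite !inE => /andP[].
have Q0 (q : Q) : 0 < above a b c (val q).
  by have := valP q; rewrite !inE => /andP[].
pose du (p q : L) : frame_differences a b P :=
  [` frame_differencesP ab (valP p) (valP q)].
pose dv (p : L) (q : Q) : frame_sq_distances a b P :=
  [` frame_sq_distancesP (valP p) (QP q) (lt0r_neq0 (Q0 q))].
apply: (@heavy_line_bound R L Q _ _ (fun p => along a b (val p))
  (fun q => along a b (val q)) (fun q => above a b c (val q)) val val du dv d) => //.
- by move=> p q /(line_points_along_inj ab (valP p) (valP q)) /val_inj.
- by move=> p q /(frame_inj ab)/val_inj.
- by rewrite -cardfE; exact: card_frame_differences.
- rewrite -cardfE; apply: leq_trans (card_frame_sq_distances a b P) _.
  by rewrite /d; lia.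
Qed.

(** Negating the equation of the line swaps its sides. The line itself holds at most [d] points, so
    the richer side has at least a quarter of [P]; this costs the factor [16 = 4 ^ 2]. *)
Lemma line_bound : exists K : nat, forall (R : realType) (a b c : R)
    (P : {fset R * R}),
  let m := #|` line_points a b c P| in
  let d := (2 * num_distances P + 1)%N in
  (a, b) <> (0, 0) -> (0 < m)%N -> (64 * d <= m ^ 2)%N ->
  (32 * d <= #|` P|)%N ->
  (#|` P| ^ 2 * m ^ 8 <= K * d ^ 9)%N.
Proof.
exists (16 * (2 * 129 ^ 4 * 2178))%N => R a b c P m d ab m_gt0 dm dP.
have ab' : (- a, - b) <> (0, 0).
  by move=> [/eqP + /eqP]; rewrite !oppr_eq0 => /eqP a0 /eqP b0; apply: ab; rewrite a0 b0.
have aboveN p : above (- a) (- b) (- c) p = - above a b c p by rewrite /above; ring.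
have lineN : line_points (- a) (- b) (- c) P = line_points a b c P.
  by apply/fsetP => p; rewrite !inE /= aboveN oppr_eq0.
pose N := #|` [fset p in P | 0 < above a b c p]|.
pose N' := #|` [fset p in P | 0 < above (- a) (- b) (- c) p]|.
have cardP : (#|` P| <= m + N + N')%N.
  have -> : P = line_points a b c P `|` [fset p in P | 0 < above a b c p]
      `|` [fset p in P | 0 < above (- a) (- b) (- c) p].
    apply/fsetP => p; rewrite !inE /= aboveN oppr_gt0.
    by case: (p \in P) => //=; case: ltgtP.
  rewrite !cardfsU -/N'; apply: leq_trans (leq_subr _ _) _.
  by rewrite leq_add2r; exact: leq_subr.
have md : (m <= d)%N := card_line_points_le c P ab.
have step n : (#|` P| <= 4 * n)%N ->
    (n ^ 2 * m ^ 8 <= 2 * 129 ^ 4 * 2178 * d ^ 9)%N ->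
    (#|` P| ^ 2 * m ^ 8 <= 16 * (2 * 129 ^ 4 * 2178) * d ^ 9)%N.
  move=> Pn le; rewrite -[leqRHS]mulnA.
  apply: leq_trans (leq_mul (leqnn 16) le); rewrite mulnA leq_mul2r.
  by rewrite -[X in (X * n ^ 2)%N]/(4 ^ 2)%N -expnMn leq_exp2r // Pn orbT.
have [NN'|/ltnW NN'] := leqP N' N.
  by apply: (step N); [lia|apply: half_plane_bound => //; lia].
apply: (step N'); first lia.
rewrite /m -lineN; apply: half_plane_bound => //; rewrite ?lineN //; lia.
Qed.

Lemma num_points_on_line (R : realType) (P : {fset R * R}) (a b c : R) :
  num_points_on P [set p : R * R | a * p.1 + b * p.2 = c] =
  #|` line_points a b c P|.
Proof.
rewrite /num_points_on; congr (#|` _|); apply/fsetP => p; rewrite !inE /=.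
congr andb; rewrite /above subr_eq0; apply/idP/eqP; first by rewrite inE.
by move=> e; rewrite inE.
Qed.

(** * The asymptotic statement *)

Lemma powR_seven_eighths (R : realType) (n : nat) :
  ((n%:R : R) `^ (7 / 8)) ^+ 8 = n%:R ^+ 7.
Proof.
rewrite -powR_mulrn ?powR_ge0 // -powRrM -powR_mulrn //.
by congr (_ `^ _); field.
Qed.

Theorem theorem1p1 (R : realType) (P : nat -> {fset R * R})
    (card_P : forall n : nat, (1 <= n)%N -> #|` P n| = n)
    (few_distances : (fun n : nat => (num_distances (P n))%:R : R)
                       =o_\oo (fun n : nat => n%:R : R)) :
  forall c : R, 0 < c ->
    exists n0 : nat, forall n : nat, (n0 <= n)%N ->
      ~ exists l : set (R * R),
          is_line l /\ c * n%:R `^ (7 / 8) <= (num_points_on (P n) l)%:R.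
Proof.
move=> c c_gt0; have [K bound] := line_bound.
pose k : R := (K * 3 ^ 9)%:R + 1.
have k_gt0 : 0 < k by rewrite ltr_wpDl.
have c8_gt0 : 0 < c ^+ 8 by rewrite exprn_gt0.
(* Since [d <= 3 * e * n], the first bound gives [64 * d <= n]; the second one serves the final
   contradiction. *)
pose e := Num.min (1 / 192) (c ^+ 8 / k).
have e_gt0 : 0 < e by rewrite lt_min !divr_gt0.
have e_le : e <= 1 / 192 by rewrite ge_min lexx.
have ek_le : k * e <= c ^+ 8.
  by rewrite mulrC -ler_pdivlMr // ge_min lexx orbT.
have /eqoP/(_ e e_gt0) := few_distances; move=> [n1 _ near_e].
(* The second threshold gives [1 <= e * n], which absorbs the [+ 1] in [d]; the third gives
   [1 <= c ^+ 8 * n], which yields [n ^ 4 <= m ^ 8]. *)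
exists (maxn n1 (maxn (Num.truncn (1 / e)).+1 (Num.truncn (1 / c ^+ 8)).+1)).
move=> n; rewrite !geq_max => /and3P[n1n en cn] [l [[a [b [g [ab ->]]]]]].
have n_ge0 : 0 <= n%:R :> R by [].
have Dn : (num_distances (P n))%:R <= e * n%:R.
  by have := near_e n n1n; rewrite /= !ger0_norm.
have en1 : 1 <= e * n%:R.
  rewrite mulrC -ler_pdivrMr // ltW // (lt_le_trans (truncnS_gt _)) //.
  by rewrite ler_nat.
have cn1 : 1 <= c ^+ 8 * n%:R.
  rewrite mulrC -ler_pdivrMr // ltW // (lt_le_trans (truncnS_gt _)) //.
  by rewrite ler_nat.
have n_gt0 : (0 < n)%N by apply: leq_trans en.
have n1R : 1 <= n%:R :> R by rewrite ler1n.
rewrite num_points_on_line.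
have := bound R a b g (P n); rewrite card_P //=.
set m := #|` _|; set d := (2 * _ + 1)%N => lem m_ge.
have dR : d%:R <= 3 * (e * n%:R) by rewrite natrD natrM; lra.
have dn : 192 * (e * n%:R) <= n%:R by rewrite mulrA ler_piMl //; lra.
have m8_ge : c ^+ 8 * n%:R ^+ 7 <= (m ^ 8)%:R.
  rewrite -powR_seven_eighths -exprMn natrX lerXn2r ?nnegrE //.
  by rewrite mulr_ge0 ?powR_ge0 // ltW.
have dn4 : (64 * d <= n)%N by rewrite -(ler_nat R) natrM; lra.
have le_n4 : (n ^ 4)%:R <= c ^+ 8 * n%:R ^+ 7 :> R.
  rewrite natrX (exprD _ 3 4) mulrA ler_peMl ?exprn_ge0 //.
  apply: le_trans cn1 _; rewrite ler_pM2l // ler_eXnr //.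
have m_gt0 : (0 < m)%N.
  rewrite -(ltr_nat R); apply: lt_le_trans m_ge.
  by rewrite mulr_gt0 ?powR_gt0 ?ltr0n.
have dm : (64 * d <= m ^ 2)%N.
  rewrite -(@leq_exp2r _ _ 4) // -expnM -(ler_nat R).
  apply: le_trans (le_trans le_n4 m8_ge).
  by rewrite ler_nat leq_exp2r.
have := lem ab m_gt0 dm (leq_trans (leq_mul (isT : 32 <= 64)%N (leqnn d)) dn4).
(* The contradicting chain is [K * d^9 <= K * (3 * e * n)^9 < k * e * n^9 <= c^8 * n^9 <= n^2 *
   m^8]; the [+ 1] in [k] makes it strict. *)
apply/negP; rewrite -ltnNge -(ltr_nat R) natrM [ltRHS]natrM.
have n9 : n%:R ^+ 9 = n%:R ^+ 2 * n%:R ^+ 7 :> R by rewrite -exprD.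
have n9_gt0 : 0 < n%:R ^+ 9 :> R by rewrite exprn_gt0 ?ltr0n.
apply: (@lt_le_trans _ _ (c ^+ 8 * n%:R ^+ 9)); last first.
  rewrite n9 mulrCA natrX ler_wpM2l ?exprn_ge0 //.
apply: (@lt_le_trans _ _ (k * e * n%:R ^+ 9)); last by rewrite ler_pM2r.
apply: (@le_lt_trans _ _ (K%:R * (3 * (e * n%:R)) ^+ 9)).
  rewrite natrX ler_wpM2l // lerXn2r ?nnegrE //.
  by rewrite !mulr_ge0 // ltW.
have -> : K%:R * (3 * (e * n%:R)) ^+ 9 = (K * 3 ^ 9)%:R * e ^+ 9 * n%:R ^+ 9.
  by rewrite natrM natrX !exprMn !mulrA.
rewrite ltr_pM2r //.
apply: (@le_lt_trans _ _ ((K * 3 ^ 9)%:R * e)).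
  by rewrite ler_wpM2l // exprSr ler_piMl ?exprn_ile1 ?ltW //; lra.
by rewrite ltr_pM2r // ltrDl.
Qed.
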